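(* Let $(N,\underline X)\in\aleph^{FGM*}$ with $E[N]<\infty$ and $E[X]<\infty$. Then $$E[S]=\sum_{(i_0,i_1)\in\{0,1\}^2}f_{I_0,I_1}(i_0,i_1)\,\mu_{N_{[1+i_0]}}\,\mu_{X_{[1+i_1]}},\qquad f_{I_0,I_1}(i_0,i_1)=\tfrac14\big(1+(-1)^{i_0+i_1}\theta_{01}\big),$$ equivalently $$E[S]=E[N]E[X]+\frac{\theta_{01}}{4}\big(\mu_{N_{[2]}}-\mu_{N_{[1]}}\big)\big(\mu_{X_{[2]}}-\mu_{X_{[1]}}\big).$$
   Context: Collective risk model (CRM): $N$ is a random variable with values in $\mathbb{N}_0$, cdf $F_N$, pmf $\gamma_N(n)=\Pr(N=n)$ and support $A_N=\{n:\gamma_N(n)>0\}$; $\underline X=\{X_j\}_{j\ge1}$ is a sequence of identically distributed strictly positive random variables with common cdf $F_X$ (generic copy $X$). The aggregate claim amount is $S=\sum_{j=1}^\infty X_j\mathbb{1}_{\{N\ge j\}}$. A $d$-variate FGM copula with parameters $\theta_{j_1\dots j_k}$ is $C(u_1,\dots,u_d)=\prod_{m=1}^d u_m\big(1+\sum_{k=2}^d\sum_{j_1<\dots<j_k}\theta_{j_1\dots j_k}\bar u_{j_1}\cdots\bar u_{j_k}\big)$, $\bar u=1-u$, with parameters such that $1+\sum_{k}\sum_{j_1<\dots<j_k}\theta_{j_1\dots j_k}\varepsilon_{j_1}\cdots\varepsilon_{j_k}\ge0$ for all $\varepsilon\in\{-1,1\}^d$. A CRM belongs to $\aleph^{FGM}$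 if for every $k\in\mathbb{N}_1$, $k\le\sup A_N$, $F_{N,X_1,\dots,X_k}(n,x_1,\dots,x_k)=C_k(F_N(n),F_X(x_1),\dots,F_X(x_k))$ for a $(k+1)$-variate FGM copula $C_k$ with coordinates indexed $0,\dots,k$ (index $0$ for $N$). It belongs to $\aleph^{FGM*}$ if in addition $(N,X_1,\dots,X_k)\overset d=(N,X_{\pi(1)},\dots,X_{\pi(k)})$ for all such $k$ and all permutations $\pi$; then $\theta_{0j}=\theta_{01}$, $\theta_{ij}=\theta_{12}$, $\theta_{0ij}=\theta_{012}$ for all $1\le i<j$. For a random variable $Y$, $Y_{[1]}$, $Y_{[2]}$ denote the minimum and maximum of two iid copies of $Y$, and $\mu_{Y_{[j]}}=E[Y_{[j]}]$. *)

(* Defs.v *)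
From HB Require Import structures.
From mathcomp Require Import all_boot all_order all_algebra all_fingroup.
From mathcomp Require Import all_classical all_reals all_analysis.
Set Implicit Arguments. Unset Strict Implicit. Unset Printing Implicit Defensive.
Import Order.TTheory GRing.Theory Num.Theory.
Local Open Scope classical_set_scope.
Local Open Scope ring_scope.

Section CRM.
Context {d : measure_display} {T : measurableType d} {R : realType}.
Variable P : probability T R.

(* d-variate FGM copula with coordinates indexed by 'I_k.+1
   (coordinate 0 = N), parameters th A for |A| >= 2 *)
Definition FGM (k : nat) (th : {set 'I_k.+1} -> R) (u : 'I_k.+1 -> R) : R :=
  (\prod_(m < k.+1) u m) *
  (1 + \sum_(A : {set 'I_k.+1} | (2 <= #|A|)%N) th A * \prod_(j in A) (1 - u j)).

Definition FGM_valid (k : nat) (th : {set 'I_k.+1} -> R) : Prop :=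
  forall eps : 'I_k.+1 -> R, (forall m, eps m = 1 \/ eps m = -1) ->
  0 <= 1 + \sum_(A : {set 'I_k.+1} | (2 <= #|A|)%N) th A * \prod_(j in A) eps j.

Definition pmfN (N : T -> nat) (n : nat) : R := fine (P [set w | N w = n]).
Definition cdfN (N : T -> nat) (n : nat) : R := fine (P [set w | (N w <= n)%N]).
Definition cdfX (X : nat -> T -> R) (x : R) : R := fine (P [set w | X 1%N w <= x]).

(* joint cdf of (N, X_{s(1)}, ..., X_{s(k)}) ; X_j is X j (j >= 1),
   and coordinate i : 'I_k corresponds to index i.+1 *)
Definition jcdf (N : T -> nat) (X : nat -> T -> R) (k : nat) (s : 'I_k -> 'I_k)
    (n : nat) (x : 'I_k -> R) : R :=
  fine (P [set w | (N w <= n)%N /\ forall i : 'I_k, X (s i).+1 w <= x i]).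

(* k <= sup A_N, where A_N = {n | gamma_N(n) > 0} *)
Definition le_supAN (N : T -> nat) (k : nat) : Prop :=
  exists n, (k <= n)%N /\ 0 < pmfN N n.

Definition in_FGMstar (N : T -> nat) (X : nat -> T -> R)
    (theta : forall k : nat, {set 'I_k.+1} -> R) : Prop :=
  forall k : nat, (1 <= k)%N -> le_supAN N k ->
    [/\ FGM_valid (theta k),
        (forall n x, jcdf N X id n x =
           FGM (theta k) (fun m : 'I_k.+1 =>
             match unlift ord0 m with None => cdfN N n | Some i => cdfX X (x i) end)) &
        (forall (s : {perm 'I_k}) n x, jcdf N X s n x = jcdf N X id n x)].

Definition aggS (N : T -> nat) (X : nat -> T -> R) (w : T) : R :=
  \sum_(1 <= j < (N w).+1) X j w.

(* E[Y_[1]] and E[Y_[2]]: expectation of min / max of two iid copies of Y,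
   realised on the product space (T * T, P \x P) *)
Definition mu_min (Y : T -> R) : \bar R :=
  (\int[P \x P]_z (Num.min (Y z.1) (Y z.2))%:E)%E.
Definition mu_max (Y : T -> R) : \bar R :=
  (\int[P \x P]_z (Num.max (Y z.1) (Y z.2))%:E)%E.
Definition mu_ord (Y : T -> R) (j : nat) : \bar R :=
  if j == 1%N then mu_min Y else mu_max Y.

End CRM.

(* Main.v *)
(** By Tonelli, E[S] is the sum over m of E[X_{m+1} 1{N > m}], and each term is
the integral over r >= 0 of P(N > m, X_{m+1} > r). Only the pair (N, X_{m+1})
enters: exchangeability reduces its joint cdf to that of (N, X_1), and the
bivariate FGM copula gives, with bars denoting tails,
P(N > m, X_{m+1} > r) = Nbar(m) Xbar(r) (1 + theta_01 F_N(m) F_X(r)).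
Summing and integrating, E[S] = E[N] E[X] + theta_01 b a, where b is the sum of
F_N Nbar and a the integral of F_X Xbar. Since E[Y_[1]] is the integral of the
squared tail of Y and Y_[1] + Y_[2] has mean 2 E[Y], one finds
E[Y_[1]] = E[Y] - a and E[Y_[2]] = E[Y] + a for Y = X, and likewise with b for
Y = N. *)
Require Import Defs.
From HB Require Import structures.
From mathcomp Require Import all_boot all_order all_algebra all_fingroup.
From mathcomp Require Import all_classical all_reals all_analysis.
From mathcomp Require Import measurable_realfun.
From mathcomp Require Import ring.
Import Order.TTheory GRing.Theory Num.Theory numFieldNormedType.Exports.
Local Open Scope classical_set_scope.
Local Open Scope ring_scope.

(** * Tail formulas for means, and sums with a random number of terms *)

Lemma integral_tail (d : measure_display) (T : measurableType d) (R : realType)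
    (Q : probability T R) (f : T -> R) :
  measurable_fun setT f -> (forall x, 0 <= f x) ->
  (\int[Q]_x (f x)%:E =
   \int[@lebesgue_measure R]_(r in `[0%R, +oo[) Q [set x | (r < f x)%R])%E.
Proof.
move=> mf f0.
pose mF := isMeasurableFun.Build _ _ _ _ f mf.
pose F : {RV Q >-> R} := HB.pack f mF.
have := @ge0_expectation_ccdf _ _ _ Q F f0.
rewrite unlock => ->; apply: eq_integral => r _.
rewrite /ccdf /distribution /pushforward; congr (Q _).
by apply/seteqP; split => x /=; rewrite in_itv/= andbT.
Qed.

(** The terms vanish from index [n] on, so the partial sums are eventually constant. This turns a
    sum with a random upper limit into a series with a fixed index set. *)
Lemma nneseries_natsum (R : realType) (u : nat -> R) (n : nat) :
  (\sum_(m <oo) (u m * (m < n)%:R)%:E = (\sum_(m < n) u m)%:E)%E.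
Proof.
apply: cvg_lim => //; apply: cvg_near_cst; near=> k => /=.
have nk : (n <= k)%N by near: k; exists n.
rewrite sumEFin (@big_cat_nat _ _ _ n)//= [X in _ + X]big1_seq ?addr0.
  rewrite big_mkord; congr EFin; apply: eq_bigr => i _.
  by rewrite ltn_ord mulr1.
move=> i; rewrite mem_index_iota => /andP[_ /andP[ni _]].
by rewrite ltnNge ni mulr0.
Unshelve. all: by end_near. Qed.

Lemma measurable_preimage_nat (d : measure_display) (T : measurableType d)
    (M : T -> nat) (B : set nat) :
  (forall n, measurable [set w | M w = n]) -> measurable (M @^-1` B).
Proof.
move=> mM; rewrite (_ : _ @^-1` _ = \bigcup_(n in B) [set w | M w = n]).
  exact: bigcup_measurable.
apply/seteqP; split => w /=; first by move=> Bw; exists (M w).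
by move=> [n Bn /= ->].
Qed.

Lemma measurable_fun_natr (d : measure_display) (T : measurableType d)
    (R : realType) (M : T -> nat) (g : nat -> R) :
  (forall n, measurable [set w | M w = n]) ->
  measurable_fun setT (fun w => g (M w)).
Proof.
move=> mM _ A mA; rewrite setTI.
exact: (@measurable_preimage_nat _ _ M (g @^-1` A) mM).
Qed.

(** Tonelli, after writing the random upper limit as the indicator of [m < M w]. No independence
    between [M] and the terms is involved. *)
Lemma integral_random_sum (d : measure_display) (T : measurableType d)
    (R : realType) (Q : probability T R) (M : T -> nat) (Y : nat -> T -> R) :
  (forall n, measurable [set w | M w = n]) ->
  (forall m, measurable_fun setT (Y m)) -> (forall m w, 0 <= Y m w) ->
  (\int[Q]_w (\sum_(m < M w) Y m w)%:E =
   \sum_(m <oo) \int[Q]_w (Y m w * (m < M w)%:R)%:E)%E.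
Proof.
move=> mM mY Y0; rewrite -integral_nneseries//.
- by apply: eq_integral => w _; rewrite nneseries_natsum.
- move=> m; apply/measurable_EFinP; apply: measurable_funM => //.
  exact: (@measurable_fun_natr _ _ _ M (fun n => (m < n)%:R)).
- by move=> m w _; rewrite lee_fin mulr_ge0.
Qed.

(** A natural number is a sum of that many ones, so this is the random sum with every term equal to
    1. *)
Lemma integral_nat_tail (d : measure_display) (T : measurableType d)
    (R : realType) (Q : probability T R) (M : T -> nat) :
  (forall n, measurable [set w | M w = n]) ->
  (\int[Q]_w ((M w)%:R)%:E = \sum_(m <oo) Q [set w | (m < M w)%N])%E.
Proof.
move=> mM; transitivity (\int[Q]_w (\sum_(m < M w) (cst 1 w : R))%:E)%E.
  by apply: eq_integral => w _; rewrite sumr_const card_ord.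
rewrite (@integral_random_sum _ _ _ Q M (fun=> cst 1))//.
apply: eq_eseriesr => m _.
have mA : measurable [set w | (m < M w)%N].
  exact: (@measurable_preimage_nat _ _ M [set n | (m < n)%N]).
rewrite -[X in _ = Q X]setIT -integral_indic//; apply: eq_integral => w _.
rewrite mul1r indicE; congr (_%:R)%:E; congr nat_of_bool.
by apply/idP/idP; rewrite inE.
Qed.

(** * Minimum and maximum of two iid copies *)

Section order_statistics.
Context (d : measure_display) (T : measurableType d) (R : realType).
Variable P : probability T R.
Local Open Scope ereal_scope.

(** Pointwise, minimum plus maximum is the sum of the two coordinates, and Tonelli integrates each
    coordinate to the mean of [Y]. By nonnegativity this holds in the extended reals even when the
    mean is infinite. *)
Lemma mu_min_max_ge0 (Y : T -> R) :
  measurable_fun setT Y -> (forall w, (0 <= Y w)%R) ->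
  mu_min P Y + mu_max P Y = \int[P]_w (Y w)%:E + \int[P]_w (Y w)%:E.
Proof.
move=> mY Y0.
have m1 : measurable_fun setT (fun z : T * T => Y z.1).
  exact: (measurableT_comp mY).
have m2 : measurable_fun setT (fun z : T * T => Y z.2).
  exact: (measurableT_comp mY).
rewrite /mu_min /mu_max -ge0_integralD//; last 4 first.
- by move=> z _; rewrite lee_fin le_min !Y0.
- by apply/measurable_EFinP; exact: measurable_minr.
- by move=> z _; rewrite lee_fin le_max !Y0.
- by apply/measurable_EFinP; exact: measurable_maxr.
transitivity (\int[P \x P]_z ((Y z.1)%:E + (Y z.2)%:E)).
  by apply: eq_integral => z _; rewrite -!EFinD addr_min_max.
rewrite ge0_integralD//; last 4 first.
- by move=> z _; rewrite lee_fin Y0.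
- by apply/measurable_EFinP.
- by move=> z _; rewrite lee_fin Y0.
- by apply/measurable_EFinP.
congr (_ + _).
- rewrite fubini_tonelli1//=; last 2 first.
  + exact/measurable_EFinP.
  + by move=> z; rewrite lee_fin.
  apply: eq_integral => w _; rewrite /fubini_F/=.
  by rewrite integral_cst//= probability_setT mule1.
- rewrite fubini_tonelli2//=; last 2 first.
  + exact/measurable_EFinP.
  + by move=> z; rewrite lee_fin.
  apply: eq_integral => w _; rewrite /fubini_G/=.
  by rewrite integral_cst//= probability_setT mule1.
Qed.

(** The minimum exceeds [r] exactly when both copies do; that event is a rectangle, so its product
    measure factorises. *)
Lemma mu_min_tail (Y : T -> R) :
  measurable_fun setT Y -> (forall w, (0 <= Y w)%R) ->
  mu_min P Y = \int[@lebesgue_measure R]_(r in `[0%R, +oo[)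
    (P [set w | (r < Y w)%R] * P [set w | (r < Y w)%R]).
Proof.
move=> mY Y0.
have m1 : measurable_fun setT (fun z : T * T => Y z.1).
  exact: (measurableT_comp mY).
have m2 : measurable_fun setT (fun z : T * T => Y z.2).
  exact: (measurableT_comp mY).
rewrite /mu_min (@integral_tail _ _ _ (P \x P)%E); last 2 first.
- exact: measurable_minr.
- by move=> z; rewrite le_min !Y0.
apply: eq_integral => r _.
have mA : measurable [set w | (r < Y w)%R].
  rewrite -[X in measurable X]setTI.
  have := measurable_fun_ltr (measurable_cst r) mY => /(_ measurableT [set true]).
  by apply.
rewrite -product_measure1E//; congr ((P \x P) _).
by apply/seteqP; split => z /=; rewrite lt_min => /andP.
Qed.

Lemma mu_min_nat_tail (M : T -> nat) :
  (forall n, measurable [set w | M w = n]) ->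
  mu_min P (fun w => ((M w)%:R)%R) =
  \sum_(m <oo) (P [set w | (m < M w)%N] * P [set w | (m < M w)%N]).
Proof.
move=> mM; have mB B := @measurable_preimage_nat _ _ M B mM.
transitivity (\int[P \x P]_z (((minn (M z.1) (M z.2))%:R)%R : R)%:E).
  apply: eq_integral => z _; congr EFin.
  by rewrite /Num.min ltr_nat /minn; case: ifP.
rewrite (@integral_nat_tail _ _ _ (P \x P)%E (fun z => minn (M z.1) (M z.2))).
  apply: eq_eseriesr => m _; have mA := mB [set n | (m < n)%N].
  rewrite -product_measure1E//; congr ((P \x P) _).
  by apply/seteqP; split => z /=; rewrite leq_min => /andP.
move=> n.
(* The fibres of the minimum are countable unions of measurable rectangles. *)
rewrite (_ : [set _ | _] = \bigcup_(a in setT) \bigcup_(b in [set b | minn a b = n])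
   ([set w | M w = a] `*` [set w | M w = b])).
  apply: bigcup_measurable => a _; apply: bigcup_measurable => b _.
  exact: measurableX.
apply/seteqP; split => z /=.
  by move=> zn; exists (M z.1) => //; exists (M z.2).
by move=> [a _ [b /= abn [/= -> ->]]].
Qed.

End order_statistics.

(** * The joint law of [N] and a single claim *)

Section marginal.
Context (d : measure_display) (T : measurableType d) (R : realType).
Variable P : probability T R.

Lemma measurable_le_RV (Y : {RV P >-> R}) (x : R) :
  measurable [set w | Y w <= x].
Proof.
rewrite -[X in measurable X]setTI.
by have := measurable_fun_ler (measurable_funPT Y) (measurable_cst x)
  => /(_ measurableT [set true]); apply.
Qed.

(** As [K] grows, the events increase to the one that constrains only coordinate [i0] and [N];
    continuity from below gives the limit. *)
Lemma cvg_jcdf (N : T -> nat) (X : nat -> {RV P >-> R}) (k : nat)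
    (s : 'I_k.+1 -> 'I_k.+1) (i0 : 'I_k.+1) (n : nat) (x : R) :
  (forall n : nat, measurable [set w | N w = n]) ->
  jcdf P N (fun j => X j) s n (fun i => if i == i0 then x else K%:R)
    @[K --> \oo] --> fine (P [set w | (N w <= n)%N /\ X (s i0).+1 w <= x]).
Proof.
move=> mN.
pose A K := [set w | (N w <= n)%N /\
  forall i, X (s i).+1 w <= if i == i0 then x else K%:R].
have mA K : measurable (A K).
  rewrite (_ : A K = [set w | (N w <= n)%N] `&`
    \bigcap_(i in setT) [set w | X (s i).+1 w <= if i == i0 then x else K%:R]).
    apply: measurableI.
      exact: (@measurable_preimage_nat _ _ N [set m | (m <= n)%N]).
    apply: fin_bigcap_measurable; first exact: finite_finset.
    by move=> i _; exact: measurable_le_RV.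
  apply/seteqP; split=> w /= [Nn H]; split => // i; last exact: H.
  by move=> _; exact: H.
have AE : \bigcup_K A K = [set w | (N w <= n)%N /\ X (s i0).+1 w <= x].
  apply/seteqP; split => w /=.
    by move=> [K _ [Nn /(_ i0)]]; rewrite eqxx.
  (* Each value lies below its truncation plus one, so the largest of these finitely many integers
     bounds all coordinates at once. *)
  move=> [Nn Hx]; exists (\max_(i < k.+1) (Num.truncn (X (s i).+1 w)).+1)%N => //.
  split=> // i; case: eqVneq => [->//|_].
  apply: (le_trans (ltW (truncnS_gt _))); rewrite ler_nat.
  exact: (@leq_bigmax _ (fun i : 'I_k.+1 => (Num.truncn (X (s i).+1 w)).+1) i).
rewrite -AE; apply: fine_cvg; rewrite fineK; last first.
  by apply: fin_num_measure; apply: bigcup_measurable => K _; exact: mA.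
apply: (nondecreasing_cvg_mu (mu := P)) => //.
  by apply: bigcup_measurable => K _; exact: mA.
move=> K L KL; apply/subsetPset => w /= [Nn H]; split => // i.
by apply: (le_trans (H i)); case: ifP => // _; rewrite ler_nat.
Qed.

(* Letting all coordinates but one of the exchangeable vector tend to infinity. *)
Lemma FGMstar_exchangeable (N : T -> nat) (X : nat -> {RV P >-> R})
    (theta : forall k : nat, {set 'I_k.+1} -> R) (m n : nat) (x : R) :
  (forall n : nat, measurable [set w | N w = n]) ->
  in_FGMstar P N (fun j => X j) theta -> le_supAN P N m.+1 ->
  fine (P [set w | (N w <= n)%N /\ X m.+1 w <= x]) =
  fine (P [set w | (N w <= n)%N /\ X 1%N w <= x]).
Proof.
move=> mN /(_ m.+1 isT) /[apply] -[_ _ exch].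
(* The finite bound [x] sits at coordinate 0, which reads [X m.+1] after the transposition of the
   first and last coordinates and [X 1] without it. *)
pose u K (i : 'I_m.+1) : R := if i == ord0 then x else K%:R.
have jcdfE : (fun K => jcdf P N (fun j => X j) (tperm ord0 ord_max) n (u K)) =
             (fun K => jcdf P N (fun j => X j) id n (u K)).
  by apply/funext => K; exact: exch.
have := @cvg_jcdf N X m (tperm ord0 ord_max) ord0 n x mN.
rewrite tpermL jcdfE => h1.
exact: (cvg_unique _ h1 (@cvg_jcdf N X m id ord0 n x mN)).
Qed.

(** Among the subsets of a two-point index set only the full one has at least two elements, so a
    single parameter survives. *)
Lemma FGM1E (th : {set 'I_2} -> R) (u : 'I_2 -> R) :
  FGM th u = u ord0 * u ord_max *
    (1 + th [set ord0; ord_max]%SET * ((1 - u ord0) * (1 - u ord_max))).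
Proof.
have oM : lift ord0 ord0 = ord_max :> 'I_2 by exact: val_inj.
rewrite /FGM !big_ord_recl big_ord0 mulr1 oM; congr (_ * (1 + _)).
rewrite (big_pred1 [set ord0; ord_max]%SET); last first.
  move=> A; rewrite /=; apply/idP/eqP => [A2|->]; last by rewrite cards2.
  have -> : [set ord0; ord_max]%SET = [set: 'I_2]%SET.
    apply/setP => i; rewrite !inE -oM; case: (unliftP ord0 i) => [j|] -> //.
    by rewrite (ord1 j) eqxx orbT.
  by apply/eqP; rewrite eqEcard finset.subsetT cardsT card_ord.
by rewrite big_setU1 ?inE//= big_set1.
Qed.

Lemma FGMstar_jcdf1 (N : T -> nat) (X : nat -> {RV P >-> R})
    (theta : forall k : nat, {set 'I_k.+1} -> R) (n : nat) (x : R) :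
  in_FGMstar P N (fun j => X j) theta -> le_supAN P N 1 ->
  let F := cdfN P N n in let G := cdfX P (fun j => X j) x in
  fine (P [set w | (N w <= n)%N /\ X 1%N w <= x]) =
  F * G * (1 + theta 1%N [set ord0; ord_max]%SET * ((1 - F) * (1 - G))).
Proof.
move=> /(_ 1%N isT) /[apply] -[_ /(_ n (fun=> x)) + _] F G.
rewrite FGM1E unlift_none (_ : ord_max = lift ord0 ord0); last exact: val_inj.
rewrite liftK => <-; congr (fine (P _)).
apply/seteqP; split => w /= [Nn H]; split => //.
  by move=> i; rewrite (ord1 i).
exact: (H ord0).
Qed.

(** The tail is a countable union of fibres, each null because no value above [m] has positive
    mass. *)
Lemma pmfN_tail0 (N : T -> nat) (m : nat) :
  (forall n : nat, measurable [set w | N w = n]) ->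
  ~ le_supAN P N m.+1 -> P [set w | (m < N w)%N] = 0%E.
Proof.
move=> mN nsup.
rewrite (_ : [set _ | _] = \bigcup_(n in [set n | (m < n)%N]) [set w | N w = n]).
  rewrite bigcup_mkcond; apply/negligibleP.
    by apply: bigcup_measurable => n _; case: ifP.
  apply: negligible_bigcup => n; case: ifPn; last by move=> _; exact: negligible_set0.
  rewrite inE/= => mn; apply/negligibleP => //; apply/eqP.
  rewrite -measure_le0 leNgt; apply/negP => Pn; apply: nsup; exists n; split => //.
  by rewrite /pmfN -lte_fin fineK ?fin_num_measure.
apply/seteqP; split => w /=; first by move=> mw; exists (N w).
by move=> [n /= mn ->].
Qed.

(** Inclusion-exclusion: 1 - F - G + F G (1 + th (1 - F)(1 - G)) factors as (1 - F)(1 - G)(1 + th F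
    G), so the bivariate FGM form passes to tails with the same parameter. *)
Lemma FGMstar_joint_tail (N : T -> nat) (X : nat -> {RV P >-> R})
    (theta : forall k : nat, {set 'I_k.+1} -> R) (m : nat) (x : R) :
  (forall n : nat, measurable [set w | N w = n]) ->
  (forall j : nat, (1 <= j)%N -> forall A : set R, measurable A ->
     P (X j @^-1` A) = P (X 1%N @^-1` A)) ->
  in_FGMstar P N (fun j => X j) theta ->
  let F := cdfN P N m in let G := cdfX P (fun j => X j) x in
  P [set w | (m < N w)%N /\ x < X m.+1 w] =
  ((1 - F) * (1 - G) * (1 + theta 1%N [set ord0; ord_max]%SET * (F * G)))%:E.
Proof.
move=> mN idX fgm F G.
pose A := [set w | (N w <= m)%N]; pose B := [set w | X m.+1 w <= x].
have mA : measurable A.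
  exact: (@measurable_preimage_nat _ _ N [set n | (n <= m)%N]).
have mB : measurable B by exact: measurable_le_RV.
have PA : P A = F%:E by rewrite /F/cdfN fineK ?fin_num_measure.
have PB : P B = G%:E.
  have -> : P B = P (X 1%N @^-1` [set y | y <= x]).
    by rewrite -(idX m.+1)// -set_itvNyc; exact: measurable_itv.
  by rewrite /G /cdfX fineK ?fin_num_measure//; exact: measurable_le_RV.
rewrite (_ : [set _ | _] = ~` (A `|` B)); last first.
  rewrite setCU; apply/seteqP; split => w /=; rewrite /A /B/=.
    by move=> [+ +]; rewrite ltnNge ltNge => /negP ? /negP.
  by move=> [/negP + /negP]; rewrite -ltnNge -ltNge.
(* The copula representation covers [X m.+1] only if [m.+1] does not exceed the supremum of the
   support of [N]. *)
case: (pselect (le_supAN P N m.+1)) => sup.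
  have sup1 : le_supAN P N 1.
    by case: sup => n [mn pn]; exists n; split => //; exact: leq_ltn_trans mn.
  have PAB : P (A `&` B) =
      (F * G * (1 + theta 1%N [set ord0; ord_max]%SET * ((1 - F) * (1 - G))))%:E.
    rewrite -(FGMstar_jcdf1 N X)// -(@FGMstar_exchangeable N X theta m m x)//.
    by rewrite fineK// fin_num_measure//; exact: measurableI.
  rewrite probability_setC //; last exact: measurableU.
  rewrite (measureUfinl mA mB) ?ltey_eq ?fin_num_measure//= PA PB PAB.
  by rewrite -EFinD; congr EFin; ring.
have PA0 : P (~` A) = 0%E.
  rewrite -(@pmfN_tail0 N m mN sup); congr (P _).
  by apply/seteqP; split => w /=; rewrite /A/= ltnNge => /negP.
(* Beyond the support of N nothing is assumed about X_{m+1}; both sides vanish. *)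
have F1 : F = 1.
  move: PA0; rewrite probability_setC// PA -EFinB => -[/eqP].
  by rewrite subr_eq0 => /eqP.
rewrite F1 subrr !mul0r; apply: subset_measure0 PA0.
- by apply: measurableC; exact: measurableU.
- exact: measurableC.
- by rewrite setCU; exact: subIsetl.
Qed.

End marginal.

(** * Linearity with a coefficient of either sign, and finiteness of the means *)

Lemma integral_affine (d : measure_display) (T : measurableType d)
    (R : realType) (mu : {measure set T -> \bar R}) (D : set T)
    (u v : T -> R) (t a b : R) :
  measurable D -> measurable_fun D u -> measurable_fun D v ->
  (forall x, 0 <= u x) -> (forall x, 0 <= v x) ->
  (\int[mu]_(x in D) (u x)%:E = a%:E)%E ->
  (\int[mu]_(x in D) (v x)%:E = b%:E)%E ->
  (\int[mu]_(x in D) (u x + t * v x)%:E = (a + t * b)%:E)%E.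
Proof.
move=> mD mu_ mv u0 v0 iu iv.
(* As [t] may be negative, additivity for nonnegative functions does not apply; the finite integrals
   supply the integrability that general linearity asks for. *)
have integrable_ge0 (f : T -> R) c : measurable_fun D f ->
    (forall x, 0 <= f x) -> (\int[mu]_(x in D) (f x)%:E = c%:E)%E ->
    mu.-integrable D (EFin \o f).
  move=> mf f0 fc; apply/integrableP; split; first exact/measurable_EFinP.
  rewrite (eq_integral (fun x => (f x)%:E)) ?fc ?ltry// => x _.
  by rewrite /= ger0_norm.
have hu := integrable_ge0 u a mu_ u0 iu.
have hv := integrable_ge0 v b mv v0 iv.
transitivity (\int[mu]_(x in D) ((u x)%:E + t%:E * (v x)%:E))%E => //.
rewrite integralD//; last exact: integrableZl.
by rewrite integralZl//= iu iv.
Qed.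

(** The terms may change sign with [t], so the limit is taken on partial sums, where both series
    converge to finite values. *)
Lemma nneseries_affine (R : realType) (u v : nat -> R) (t a b : R) :
  (forall m, 0 <= u m) -> (forall m, 0 <= v m) ->
  (\sum_(m <oo) (u m)%:E = a%:E)%E -> (\sum_(m <oo) (v m)%:E = b%:E)%E ->
  (\sum_(m <oo) (u m + t * v m)%:E = (a + t * b)%:E)%E.
Proof.
move=> u0 v0 su sv.
have cvg_series (f : nat -> R) c : (forall m, 0 <= f m) ->
    (\sum_(m <oo) (f m)%:E = c%:E)%E ->
    (\sum_(0 <= m < n) (f m)%:E @[n --> \oo] --> c%:E)%E.
  by move=> f0 <-; apply: is_cvg_nneseries => m _ _; rewrite lee_fin.
apply: cvg_lim => //.
rewrite [X in X @ _](_ : _ = (fun n => \sum_(0 <= m < n) (u m)%:E +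
    t%:E * \sum_(0 <= m < n) (v m)%:E)%E).
  rewrite EFinD EFinM; apply: cvgeD => //; first exact: cvg_series.
  by apply: cvgeZl => //; exact: cvg_series.
apply/funext => n; rewrite !sumEFin -EFinM -EFinD big_split/=; congr (_ + _)%:E.
by rewrite mulr_sumr.
Qed.

(** A finite sum of nonnegative terms has finite terms, so every quantity is real and the equations
    can be solved: m = e - a and M = 2e - m = e + a. *)
Lemma min_max_split (R : realType) (E A m M : \bar R) :
  (0 <= A -> 0 <= m -> 0 <= M -> E < +oo -> E = m + A -> m + M = E + E ->
  exists e a : R, [/\ E = e%:E, A = a%:E, m = (e - a)%:E & M = (e + a)%:E])%E.
Proof.
case: A => [a||]//; case: m => [m||]//; case: M => [M||]//; case: E => [e||]//.
rewrite !lee_fin => a0 m0 M0 _ [eE] [mM]; exists e, a; split => //; congr EFin.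
  by rewrite eE; ring.
by apply: (@addrI _ m); rewrite mM eE; ring.
Qed.

(** * Order-statistic means of [X] and of [N] as mean minus or plus a spread *)

Section order_statistic_means.
Context (d : measure_display) (T : measurableType d) (R : realType).
Variable P : probability T R.
Let mu : {measure set _ -> \bar R} := @lebesgue_measure R.

Lemma RV_order_means (X : {RV P >-> R}) (F : R -> R) :
  (forall w, 0 < X w) -> (forall r, F r = fine (P [set w | X w <= r])) ->
  ('E_P[X] < +oo)%E ->
  exists e a : R, [/\ 'E_P[X]%E = e%:E, mu_min P X = (e - a)%:E,
    mu_max P X = (e + a)%:E & [/\ measurable_fun setT F,
    (forall r, 0 <= F r <= 1),
    (\int[mu]_(r in `[0%R, +oo[) (1 - F r)%:E = e%:E)%E &
    (\int[mu]_(r in `[0%R, +oo[) (F r * (1 - F r))%:E = a%:E)%E]].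
Proof.
move=> X0 FE EX; have {}X0 w : 0 <= X w by exact: ltW.
have mX : measurable_fun setT X by [].
have PF r : P [set w | X w <= r] = (F r)%:E.
  by rewrite FE fineK// fin_num_measure//; exact: measurable_le_RV.
have PS r : P [set w | r < X w] = (1 - F r)%:E.
  rewrite EFinB -PF -probability_setC; last exact: measurable_le_RV.
  by congr (P _); apply/seteqP; split => w /=; rewrite ltNge => /negP.
have mF : measurable_fun setT F.
  apply/measurable_EFinP; rewrite (_ : _ \o _ = cdf X); first exact: cdf_measurable.
  apply/funext => r /=; rewrite -PF /cdf /distribution /pushforward.
  by congr (P _); apply/seteqP; split => w /=; rewrite in_itv.
have F01 r : 0 <= F r <= 1.
  by rewrite -!lee_fin -PF measure_ge0 probability_le1//; exact: measurable_le_RV.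
have m1F : measurable_fun (`[0%R, +oo[%classic : set R) (fun r => 1 - F r).
  by apply: measurable_funTS; exact: measurable_funB.
have mFF : measurable_fun (`[0%R, +oo[%classic : set R) (fun r => F r * (1 - F r)).
  by apply: measurable_funTS; apply: measurable_funM => //; exact: measurable_funB.
have F0 r : 0 <= F r by case/andP: (F01 r).
have S0 r : 0 <= 1 - F r by rewrite subr_ge0; case/andP: (F01 r).
have EXE : 'E_P[X]%E = (\int[mu]_(r in `[0%R, +oo[) (1 - F r)%:E)%E.
  by rewrite unlock integral_tail//; apply: eq_integral => r _; exact: PS.
have minE : mu_min P X =
    (\int[mu]_(r in `[0%R, +oo[) ((1 - F r) * (1 - F r))%:E)%E.
  by rewrite mu_min_tail//; apply: eq_integral => r _; rewrite !PS.
have [||||||e [a [Ee ae mine maxe]]] := @min_max_split R 'E_P[X]%E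
  (\int[mu]_(r in `[0%R, +oo[) (F r * (1 - F r))%:E)%E (mu_min P X) (mu_max P X).
- by apply: integral_ge0 => r _; rewrite lee_fin mulr_ge0.
- by apply: integral_ge0 => z _; rewrite lee_fin le_min !X0.
- by apply: integral_ge0 => z _; rewrite lee_fin le_max !X0.
- exact: EX.
(* Integrates the identity 1 - F = (1 - F)^2 + F (1 - F), whose first term is the tail of the
   minimum. *)
- rewrite EXE minE -ge0_integralD//=; last 4 first.
  + by move=> r _; rewrite lee_fin mulr_ge0.
  + by apply/measurable_EFinP; exact: measurable_funM.
  + by move=> r _; rewrite lee_fin mulr_ge0.
  + exact/measurable_EFinP.
  by apply: eq_integral => r _; rewrite -EFinD; congr EFin; ring.
- by rewrite mu_min_max_ge0// unlock.
by exists e, a; split => //; split => //; rewrite -EXE.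
Qed.

(** Discrete counterpart of [RV_order_means]: series over [m] replace integrals over [r], which fits
    the series over [m] produced by the random sum. *)
Lemma nat_order_means (N : T -> nat) :
  (forall n : nat, measurable [set w | N w = n]) ->
  let Nr := fun w => (N w)%:R : R in let F := cdfN P N in
  ('E_P[Nr] < +oo)%E ->
  exists e a : R, [/\ 'E_P[Nr]%E = e%:E, mu_min P Nr = (e - a)%:E,
    mu_max P Nr = (e + a)%:E & [/\ (forall m, 0 <= F m <= 1),
    (\sum_(m <oo) (1 - F m)%:E = e%:E)%E &
    (\sum_(m <oo) (F m * (1 - F m))%:E = a%:E)%E]].
Proof.
move=> mN Nr F EN.
have mB B := @measurable_preimage_nat _ _ N B mN.
have PF m : P [set w | (N w <= m)%N] = (F m)%:E.
  by rewrite /F /cdfN fineK// fin_num_measure//; exact: (mB [set n | (n <= m)%N]).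
have PS m : P [set w | (m < N w)%N] = (1 - F m)%:E.
  rewrite EFinB -PF -probability_setC; last exact: (mB [set n | (n <= m)%N]).
  by congr (P _); apply/seteqP; split => w /=; rewrite ltnNge => /negP.
have F01 m : 0 <= F m <= 1.
  rewrite -!lee_fin -PF measure_ge0 probability_le1//.
  exact: (mB [set n | (n <= m)%N]).
have F0 m : 0 <= F m by case/andP: (F01 m).
have S0 m : 0 <= 1 - F m by rewrite subr_ge0; case/andP: (F01 m).
have ENE : 'E_P[Nr]%E = (\sum_(m <oo) (1 - F m)%:E)%E.
  by rewrite unlock integral_nat_tail//; apply: eq_eseriesr => m _; exact: PS.
have minE : mu_min P Nr = (\sum_(m <oo) ((1 - F m) * (1 - F m))%:E)%E.
  by rewrite mu_min_nat_tail//; apply: eq_eseriesr => m _; rewrite !PS.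
have [||||||e [a [Ee ae mine maxe]]] := @min_max_split R 'E_P[Nr]%E
  (\sum_(m <oo) (F m * (1 - F m))%:E)%E (mu_min P Nr) (mu_max P Nr).
- by apply: nneseries_ge0 => m _ _; rewrite lee_fin mulr_ge0.
- by apply: integral_ge0 => z _; rewrite lee_fin le_min !ler0n.
- by apply: integral_ge0 => z _; rewrite lee_fin le_max !ler0n.
- exact: EN.
- rewrite ENE minE -nneseriesD; last 2 first.
  + by move=> m _ _; rewrite lee_fin mulr_ge0.
  + by move=> m _ _; rewrite lee_fin mulr_ge0.
  by apply: eq_eseriesr => m _; rewrite -EFinD; congr EFin; ring.
- rewrite mu_min_max_ge0 ?unlock//.
  exact: (@measurable_fun_natr _ _ _ N (fun n => n%:R)).
by exists e, a; split => //; split => //; rewrite -ENE.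
Qed.

End order_statistic_means.

(** * The mean of the aggregate claim amount *)

Theorem mainTheorem8 (d : measure_display) (T : measurableType d) (R : realType)
    (P : probability T R) (N : T -> nat) (X : nat -> {RV P >-> R})
    (theta : forall k : nat, {set 'I_k.+1} -> R) :
  (forall n : nat, measurable [set w | N w = n]) ->
  (forall j : nat, (1 <= j)%N -> forall w, 0 < X j w) ->
  (forall j : nat, (1 <= j)%N -> forall A : set R, measurable A ->
     P (X j @^-1` A) = P (X 1%N @^-1` A)) ->
  in_FGMstar P N (fun j => X j) theta ->
  ('E_P[fun w => (N w)%:R] < +oo)%E ->
  ('E_P[X 1%N] < +oo)%E ->
  let th01 := theta 1%N ([set ord0; ord_max])%SET in
  let muN := mu_ord P (fun w => (N w)%:R) in
  let muX := mu_ord P (X 1%N) in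
  ('E_P[aggS N (fun j => X j)] =
     \sum_(i0 < 2) \sum_(i1 < 2)
        ((1 + (-1) ^+ (i0 + i1) * th01) / 4)%:E * muN i0.+1 * muX i1.+1)%E
  /\
  ('E_P[aggS N (fun j => X j)] =
     'E_P[fun w => (N w)%:R] * 'E_P[X 1%N]
     + (th01 / 4)%:E * (muN 2%N - muN 1%N) * (muX 2%N - muX 1%N))%E.
Proof.
move=> mN X0 idX fgm EN EX th01 muN muX.
have [n [b [ENE minN maxN [F01 sumS sumFS]]]] :=
  @nat_order_means _ _ _ P N mN EN.
have [e [a [EXE minX maxX [mG G01 intS intGS]]]] :=
  @RV_order_means _ _ _ P (X 1%N) (cdfX P (fun j => X j)) (X0 1%N isT)
    (fun=> erefl) EX.
set F := cdfN P N in F01 sumS sumFS.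
set G := cdfX P (fun j => X j) in mG G01 intS intGS.
have F0 m : 0 <= F m by case/andP: (F01 m).
have FS0 m : 0 <= 1 - F m by rewrite subr_ge0; case/andP: (F01 m).
have G0 m : 0 <= G m by case/andP: (G01 m).
have GS0 m : 0 <= 1 - G m by rewrite subr_ge0; case/andP: (G01 m).
have mGS : measurable_fun setT (fun r => 1 - G r) by exact: measurable_funB.
(* The contribution of claim [m.+1]: its joint tail is a part in 1 - G plus [th01] times a part in G
   (1 - G), which integrate to [e] and [a]. *)
have claim m : (\int[P]_w (X m.+1 w * (m < N w)%:R)%:E =
    ((1 - F m) * e + th01 * ((F m * (1 - F m)) * a))%:E)%E.
  rewrite integral_tail; last 2 first.
  - apply: measurable_funM => //.
    exact: (@measurable_fun_natr _ _ _ N (fun n => (m < n)%:R)).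
  - by move=> w; rewrite mulr_ge0// ltW// X0.
  have scaled (f : R -> R) (c k : R) : 0 <= c -> (forall r, 0 <= f r) ->
      measurable_fun setT f ->
      (\int[@lebesgue_measure R]_(r in `[0%R, +oo[) (f r)%:E = k%:E)%E ->
      (\int[@lebesgue_measure R]_(r in `[0%R, +oo[) (c * f r)%:E = (c * k)%:E)%E.
    move=> c0 f0 mf fk; under eq_integral do rewrite EFinM.
    rewrite ge0_integralZl_EFin// ?fk//.
      by move=> r _; rewrite lee_fin.
    by apply/measurable_EFinP; exact: measurable_funTS.
  have iS := scaled _ (1 - F m) e (FS0 m) GS0 mGS intS.
  have mGGS : measurable_fun setT (fun r => G r * (1 - G r)).
    exact: measurable_funM.
  have iGS := scaled _ (F m * (1 - F m)) a (mulr_ge0 (F0 m) (FS0 m))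
    (fun r => mulr_ge0 (G0 r) (GS0 r)) mGGS intGS.
  rewrite -(@integral_affine _ _ _ _ _ _ _ th01 _ _ _ _ _ _ _ iS iGS)//.
  - apply: eq_integral => r; rewrite inE/= in_itv/= andbT => r0.
    (* Where [N w <= m] the product is 0, which does not exceed [r] because [r] is nonnegative. *)
    rewrite (_ : [set _ | _] = [set w | (m < N w)%N /\ r < X m.+1 w]).
      by rewrite (@FGMstar_joint_tail _ _ _ P N X theta)//; congr EFin; rewrite -/F -/G -/th01; ring.
    apply/seteqP; split => w /=.
      case: ltnP => _; first by rewrite mulr1.
      by rewrite mulr0 ltNge r0.
    by move=> [-> ?]; rewrite mulr1.
  - by apply: measurable_funTS; exact: measurable_funM.
  - by apply: measurable_funTS; exact: measurable_funM.
  - by move=> r; rewrite mulr_ge0.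
  - by move=> r; rewrite !mulr_ge0.
have ES : ('E_P[aggS N (fun j => X j)] = (n * e + th01 * (b * a))%:E)%E.
  rewrite unlock.
  (* Reindexing by m = j - 1 turns the condition that [N] is at least j into [m < N w]. *)
  transitivity (\int[P]_w (\sum_(m < N w) X m.+1 w)%:E)%E.
    by apply: eq_integral => w _; rewrite /aggS big_add1/= big_mkord.
  rewrite (@integral_random_sum _ _ _ P N (fun m => X m.+1))//; last first.
    by move=> m w; exact/ltW/X0.
  have e0 : 0 <= e.
    by rewrite -lee_fin -intS; apply: integral_ge0 => r _; rewrite lee_fin.
  have a0 : 0 <= a.
    rewrite -lee_fin -intGS; apply: integral_ge0 => r _.
    by rewrite lee_fin mulr_ge0.
  have scaled (f : nat -> R) (c k : R) : 0 <= c -> (forall r, 0 <= f r) ->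
      (\sum_(m <oo) (f m)%:E = k%:E)%E ->
      (\sum_(m <oo) (f m * c)%:E = (k * c)%:E)%E.
    move=> c0 f0 fk.
    rewrite mulrC EFinM -fk -nneseriesZl; last by move=> m _; rewrite lee_fin.
    by apply: eq_eseriesr => m _; rewrite mulrC EFinM.
  rewrite -(@nneseries_affine _ _ _ th01 _ _ _ _ (scaled _ e n e0 FS0 sumS)
    (scaled _ a b a0 (fun m => mulr_ge0 (F0 m) (FS0 m)) sumFS)).
  - exact: eq_eseriesr.
  - by move=> m; rewrite mulr_ge0.
  - by move=> m; rewrite !mulr_ge0.
have muN1 : muN 1%N = (n - b)%:E by [].
have muN2 : muN 2%N = (n + b)%:E by [].
have muX1 : muX 1%N = (e - a)%:E by [].
have muX2 : muX 2%N = (e + a)%:E by [].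
split; rewrite ES.
(* The four products of means add up to 4 n e; with the signs (-1)^(i0 + i1) they add up to
   (-2b)(-2a) = 4 b a. *)
- rewrite !big_ord_recl !big_ord0 /= muN1 muN2 muX1 muX2 !adde0.
  rewrite -!EFinM -!EFinD; congr EFin.
  by rewrite /bump/= !exprS expr0; field.
(* The differences of the means are 2b and 2a, so the factor 1/4 cancels. *)
- rewrite ENE EXE muN1 muN2 muX1 muX2 -!EFinB -!EFinM -EFinD; congr EFin.
  by field.
Qed.
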